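(* Let $L>0$, $\Omega=(0,L)^3$, $0<\varepsilon<1$, let $N\in\mathbb{N}$, $h=L/N$, and let $u^0\in\mathcal{C}_{\rm per}$ be an arbitrary periodic grid function. Let $C_2,C_3>0$ be constants depending only on $\Omega$ (in particular independent of $h$, $\kappa$ and $f$) such that for every $f\in\mathcal{C}_{\rm per}$ $$\|f\|_\infty\le C_2\big(|\overline{f}|+\|\Delta_h f\|_2\big),\qquad \|\nabla_h f\|_2\le C_3\|\Delta_h f\|_2 .$$ Put $\beta_0=\overline{u^0}$, $\tilde C_0=E_h(u^0)$ and $$\tilde C_1=2\big(\tilde C_0+|\Omega|\big)^{1/2},\quad \tilde C_2=C_2(|\beta_0|+\tilde C_1),\quad \tilde C_3=3\tilde C_2^2C_3\tilde C_1,\quad \tilde C_4=\sqrt{2\tilde C_1^2+1},$$ $$\tilde C_5=C_2(|\beta_0|+\tilde C_4),\quad \tilde C_6=3\tilde C_5^2C_3\tilde C_4,\quad \tilde C_9=\sqrt{7\tilde C_1^2+4+\tfrac38(\tilde C_2+\tilde C_4)^2},\quad \tilde C_{10}=C_2(|\beta_0|+\tilde C_9).$$ Take the stabilization parameter $$\kappa=\max\Big(\frac{3\tilde C_{10}^2-\varepsilon}{2},\,1\Big)$$ and any time step size $\tau>0$ with $$\tau\le\min\Big\{\kappa^{-3/2},\ \frac{1}{32}C_3^{-2},\ \frac1{36}\tilde C_3^{-2},\ \frac1{12}\tilde C_6^{-2}\Big\}.$$ Then for every $N_T\in\mathbb{N}$ the numerical solution $\{u^n\}_{0\le n\le N_T}$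 generated from $u^0$ by the ETDRK2 scheme $$\tilde u^{n+1}=\phi_0(\tau L_\kappa)u^n+\tau\phi_1(\tau L_\kappa)f_\kappa(u^n),$$ $$u^{n+1}=\phi_0(\tau L_\kappa)u^n+\tau\Big(\big(\phi_1(\tau L_\kappa)-\phi_2(\tau L_\kappa)\big)f_\kappa(u^n)+\phi_2(\tau L_\kappa)f_\kappa(\tilde u^{n+1})\Big)$$ satisfies $E_h(u^{n+1})\le E_h(u^n)$ for all $0\le n\le N_T-1$.
   Context: Grid functions. $\mathcal{C}_{\rm per}$ is the space of real grid functions $f=(f_{i,j,k})_{i,j,k\in\mathbb{Z}}$ that are $N$-periodic in each index, with $f_{i,j,k}$ the value at $(ih,jh,kh)$, $h=L/N$. The discrete inner product and norms are $\langle f,g\rangle=h^3\sum_{i,j,k=1}^N f_{i,j,k}g_{i,j,k}$, $\|f\|_2=\langle f,f\rangle^{1/2}$, $\|f\|_\infty=\max_{1\le i,j,k\le N}|f_{i,j,k}|$, and the mean is $\overline f=\frac{1}{|\Omega|}\langle f,1\rangle$ with $|\Omega|=L^3$. Difference operators. $\nabla_h f=(D_xf,D_yf,D_zf)$ with $D_xf_{i+1/2,j,k}=\frac1h(f_{i+1,j,k}-f_{i,j,k})$ and similarly $D_y,D_z$; $\|\nabla_h f\|_2^2=h^3\sum_{i,j,k=1}^N\big(|D_xf_{i+1/2,j,k}|^2+|D_yf_{i,j+1/2,k}|^2+|D_zf_{i,j,k+1/2}|^2\big)$. $\Delta_h$ is the standard seven-point discrete Laplacian, $\Delta_h f_{i,j,k}=h^{-2}(f_{i+1,j,k}+f_{i-1,j,k}+f_{i,j+1,k}+f_{i,j-1,k}+f_{i,j,k+1}+f_{i,j,k-1}-6f_{i,j,k})$.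 Splitting. $L_\kappa=-\Delta_h\big((I+\Delta_h)^2+\kappa I\big)$, a symmetric positive semidefinite operator on $\mathcal{C}_{\rm per}$, and $f_\kappa(u)=\Delta_h(u^3)-(\varepsilon+\kappa)\Delta_h u$ (powers taken pointwise). This comes from the space-discrete phase field crystal equation $\frac{du}{dt}=\Delta_h(u^3)-\varepsilon\Delta_hu+\Delta_h(I+\Delta_h)^2u=-L_\kappa u+f_\kappa(u)$. $\phi$-functions. $\phi_0(a)=e^{-a}$, $\phi_1(a)=\frac{1-e^{-a}}{a}$, $\phi_2(a)=\frac{a-(1-e^{-a})}{a^2}$ for $a>0$, extended by continuity to $a=0$ ($\phi_0(0)=\phi_1(0)=1$, $\phi_2(0)=\frac12$); $\phi_j(\tau L_\kappa)$ is defined by the spectral (functional) calculus of the symmetric operator $\tau L_\kappa$, i.e. by acting on each discrete Fourier mode. Discrete energy. $E_h(u)=\frac14\langle u^4,1\rangle+\frac{1-\varepsilon}{2}\|u\|_2^2-\|\nabla_hu\|_2^2+\frac12\|\Delta_hu\|_2^2$. Constants $C_2,C_3$ depending only on $\Omega$ with the two stated discrete Sobolev-type inequalities, uniformly in $N$, are known to exist. *)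

(* Defs.v *)
From HB Require Import structures.
From mathcomp Require Import all_boot all_order all_algebra.
From mathcomp Require Import all_classical all_reals all_analysis.
From mathcomp Require Import ring.

Set Implicit Arguments.
Unset Strict Implicit.
Unset Printing Implicit Defensive.

Import Order.TTheory GRing.Theory Num.Theory.
Import numFieldNormedType.Exports.

Local Open Scope classical_set_scope.
Local Open Scope ring_scope.

(* An N-periodic grid function on Z^3 is encoded by its restriction to one
   period: indices live in 'I_N, the index shifts i |-> i + 1 and i |-> i - 1
   are the cyclic ordS and ord_pred, and the node N of the usual range 1..N is
   identified with 0. *)
Notation grid R N := ('I_N -> 'I_N -> 'I_N -> R^o).

Definition mesh (R : realType) (L : R) (N : nat) : R := L / N%:R.

Section PhaseFieldCrystal.

Context {R : realType} (L : R) {N : nat}.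
Local Notation h := (mesh L N).

Implicit Types (f g u : grid R N) (A T : grid R N -> grid R N).

Definition inner f g : R :=
  h ^+ 3 * \sum_(i < N) \sum_(j < N) \sum_(k < N) f i j k * g i j k.

Definition norm2 f : R := Num.sqrt (inner f f).

Definition norm_sup f : R :=
  \big[Num.max/0]_(i < N) \big[Num.max/0]_(j < N) \big[Num.max/0]_(k < N)
    `|f i j k|.

Definition vol : R := L ^+ 3.

Definition mean f : R := vol^-1 * inner f (fun _ _ _ => 1).

(* The edge-centred value D_x f_{i+1/2,j,k} is stored at (i,j,k); same for the
   other two directions. *)
Definition Dx f : grid R N := fun i j k => (f (ordS i) j k - f i j k) / h.
Definition Dy f : grid R N := fun i j k => (f i (ordS j) k - f i j k) / h.
Definition Dz f : grid R N := fun i j k => (f i j (ordS k) - f i j k) / h.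

Definition norm2_grad f : R :=
  Num.sqrt (h ^+ 3 * \sum_(i < N) \sum_(j < N) \sum_(k < N)
    (`|Dx f i j k| ^+ 2 + `|Dy f i j k| ^+ 2 + `|Dz f i j k| ^+ 2)).

Definition lap f : grid R N := fun i j k =>
  h ^- 2 * (f (ordS i) j k + f (ord_pred i) j k
             + f i (ordS j) k + f i (ord_pred j) k
             + f i j (ordS k) + f i j (ord_pred k) - 6 * f i j k).

Definition I_plus_lap f : grid R N := f + lap f.

Definition Lop (kappa : R) f : grid R N :=
  - lap (I_plus_lap (I_plus_lap f) + kappa *: f).

Definition fop (eps kappa : R) u : grid R N :=
  lap (fun i j k => u i j k ^+ 3) - (eps + kappa) *: lap u.

Definition energy (eps : R) u : R :=
  4^-1 * inner (fun i j k => u i j k ^+ 4) (fun _ _ _ => 1)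
  + (1 - eps) / 2 * norm2 u ^+ 2
  - norm2_grad u ^+ 2
  + 2^-1 * norm2 (lap u) ^+ 2.

(* T is phi(A): for a diagonalizable A this determines T. *)
Definition is_calculus (phi : R -> R) A T : Prop :=
  linear T /\
  forall (lam : R) (v : grid R N), A v = lam *: v -> T v = phi lam *: v.

(* phi(A), by choice of the T above; is_calculus_LopP below proves existence and
   uniqueness of T for A = tau *: Lop kappa. *)
Definition calculus (phi : R -> R) A : grid R N -> grid R N :=
  xget (fun f : grid R N => f) [set T | is_calculus phi A T].

(* Only the values at a >= 0 matter, tau *: Lop kappa being positive
   semidefinite. *)
Definition phi0 (a : R) : R := expR (- a).
Definition phi1 (a : R) : R := if a == 0 then 1 else (1 - expR (- a)) / a.
Definition phi2 (a : R) : R :=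
  if a == 0 then 2^-1 else (a - (1 - expR (- a))) / a ^+ 2.

Definition phiL (phi : R -> R) (tau kappa : R) : grid R N -> grid R N :=
  calculus phi (fun f => tau *: Lop kappa f).

Definition etdrk2_predictor (eps kappa tau : R) u : grid R N :=
  phiL phi0 tau kappa u + tau *: phiL phi1 tau kappa (fop eps kappa u).

Definition etdrk2_step (eps kappa tau : R) u : grid R N :=
  phiL phi0 tau kappa u
  + tau *: ((phiL phi1 tau kappa (fop eps kappa u)
             - phiL phi2 tau kappa (fop eps kappa u))
            + phiL phi2 tau kappa
                (fop eps kappa (etdrk2_predictor eps kappa tau u))).

End PhaseFieldCrystal.

Section CalculusWellDefined.

Context {R : realType} (L : R) {N : nat} (hN : (0 < N)%N).

Let w : R := pi *+ 2 / N%:R.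

Let N0 : N%:R != 0 :> R. Proof. by rewrite pnatr_eq0 -lt0n. Qed.

Let wN : w * N%:R = pi *+ 2. Proof. by rewrite /w mulfVK. Qed.

Let ang (a b d : 'I_N) : R := w * a%:R * (b%:R - d%:R).

Let half_sin_neq0 (b d : 'I_N) : b != d -> sin (w * (b%:R - d%:R) / 2) != 0.
Proof.
move=> bd; wlog db : b d bd / (d < b)%N => [H|].
  case: (ltngtP d b) => [h|h|h]; first exact: H.
  - have := H d b _ h; rewrite eq_sym => /(_ bd).
    by rewrite -opprB mulrN mulNr sinN oppr_eq0.
  - by move: bd; rewrite -val_eqE /= h eqxx.
rewrite gt_eqF// sin_gt0_pi// -natrB 1?ltnW//.
have n0 : 0 < N%:R :> R by rewrite ltr0n.
have -> : w * (b - d)%:R / 2 = pi * ((b - d)%:R / N%:R) by rewrite /w; field.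
rewrite mulr_gt0 ?pi_gt0 ?divr_gt0 ?ltr0n ?subn_gt0//=.
rewrite gtr_pMr ?pi_gt0// ltr_pdivrMr// mul1r ltr_nat.
exact: leq_ltn_trans (leq_subr _ _) _.
Qed.

Let angN (b d : 'I_N) x (t := w * (b%:R - d%:R)) :
  (sin (N%:R * t + x) = sin x) * (cos (N%:R * t + x) = cos x).
Proof.
have E : N%:R * t + x + (pi *+ 2) *+ d = x + (pi *+ 2) *+ b.
  rewrite /t -!(mulr_natr (pi *+ 2)) -wN; ring.
split.
  by rewrite -(periodicn (@sinD2pi R) d) E (periodicn (@sinD2pi R)).
by rewrite -(periodicn (@cosD2pi R) d) E (periodicn (@cosD2pi R)).
Qed.

Let sum_sin (b d : 'I_N) : \sum_(a < N) sin (ang a b d) = 0.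
Proof.
have [->|bd] := eqVneq b d.
  by rewrite big1// => a _; rewrite /ang subrr mulr0 sin0.
set t := w * (b%:R - d%:R).
have s0 : 2 * sin (t / 2) != 0 by rewrite mulf_neq0 ?half_sin_neq0 ?pnatr_eq0.
apply: (mulfI s0); rewrite mulr0 mulr_sumr.
rewrite -(big_mkord xpredT (fun a => 2 * sin (t / 2) * sin (w * a%:R * (b%:R - d%:R)))).
rewrite (@telescope_sumr_eq _ _ _ (fun a => - cos (a%:R * t - t / 2)))//.
  by rewrite (angN _ _ _).2 mul0r add0r opprK addNr.
move=> k _; rewrite -[k.+1%:R]natr1.
have -> : w * k%:R * (b%:R - d%:R) = k%:R * t by rewrite /t; ring.
have -> : (k%:R + 1) * t - t / 2 = k%:R * t + t / 2 by field.
rewrite cosD cosB; ring.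
Qed.

Let sum_cos (b d : 'I_N) :
  \sum_(a < N) cos (ang a b d) = N%:R * (b == d)%:R.
Proof.
have [->|bd] := eqVneq b d.
  rewrite (eq_bigr (fun=> 1)) => [|a _]; last by rewrite /ang subrr mulr0 cos0.
  by rewrite sumr_const card_ord mulr1.
set t := w * (b%:R - d%:R).
have s0 : 2 * sin (t / 2) != 0 by rewrite mulf_neq0 ?half_sin_neq0 ?pnatr_eq0.
apply: (mulfI s0); rewrite !mulr0 mulr_sumr.
rewrite -(big_mkord xpredT (fun a => 2 * sin (t / 2) * cos (w * a%:R * (b%:R - d%:R)))).
rewrite (@telescope_sumr_eq _ _ _ (fun a => sin (a%:R * t - t / 2)))//.
  by rewrite (angN _ _ _).1 mul0r add0r subrr.
move=> k _; rewrite -[k.+1%:R]natr1.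
have -> : w * k%:R * (b%:R - d%:R) = k%:R * t by rewrite /t; ring.
have -> : (k%:R + 1) * t - t / 2 = k%:R * t + t / 2 by field.
rewrite sinD sinB; ring.
Qed.

Let cos_angS x (a b d : 'I_N) :
  cos (x + ang a (ordS b) d) = cos (x + ang a b d + w * a%:R).
Proof.
rewrite -(periodicn (@cosD2pi R) (a * (b.+1 %/ N))); congr cos.
have : b.+1%:R = (b.+1 %/ N)%:R * N%:R + (b.+1 %% N)%:R :> R.
  by rewrite -natrM -natrD -divn_eq.
rewrite -(mulr_natr (pi *+ 2)) -wN /ang /= natrM -[b.+1%:R]natr1 => H.
have -> : (b.+1 %% N)%:R = (b%:R + 1) - (b.+1 %/ N)%:R * N%:R :> R.
  by rewrite H addrAC subrr add0r.
ring.
Qed.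

Let cos_angP x (a b d : 'I_N) :
  cos (x + ang a (ord_pred b) d) = cos (x + ang a b d - w * a%:R).
Proof.
rewrite -{2}(ord_predK b) addrAC cos_angS; congr cos; ring.
Qed.

Let Q : finType := ('I_N * 'I_N * 'I_N)%type.

Let at_ (f : grid R N) (q : Q) : R := f q.1.1 q.1.2 q.2.

(* Real Fourier mode of wave vector p, translated by y. *)
Let mode (p y : Q) : grid R N := fun i j k =>
  cos (ang p.1.1 i y.1.1 + ang p.1.2 j y.1.2 + ang p.2 k y.2).

Let modeC p x y : at_ (mode p x) y = at_ (mode p y) x.
Proof. rewrite /at_ /mode -cosN; congr cos; rewrite /ang; ring. Qed.

Let lam (p : Q) : R := (mesh L N) ^- 2 *
  (2 * cos (w * p.1.1%:R) + 2 * cos (w * p.1.2%:R) + 2 * cos (w * p.2%:R) - 6).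

Let lap_mode p y : lap L (mode p y) = lam p *: mode p y.
Proof.
apply/funext => i; apply/funext => j; apply/funext => k.
rewrite /lap /GRing.scale /= /mode /lam -[RHS]mulrA; congr (_ * _).
set a := ang p.1.1 i y.1.1; set b := ang p.1.2 j y.1.2.
set c := ang p.2 k y.2.
have P1 z : cos (z + b + c) = cos (b + c + z) by congr cos; ring.
have P2 z : cos (a + z + c) = cos (a + c + z) by congr cos; ring.
rewrite (P1 (ang _ (ordS _) _)) (P1 (ang _ (ord_pred _) _)).
rewrite (P2 (ang _ (ordS _) _)) (P2 (ang _ (ord_pred _) _)).
rewrite !cos_angS !cos_angP -/a -/b -/c.
have -> : b + c + a = a + b + c by ring.
have -> : a + c + b = a + b + c by ring.
rewrite !(cosD (a + b + c)) !cosN !sinN; ring.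
Qed.

Let sE a (f : grid R N) i j k : (a *: f) i j k = a * f i j k.
Proof. by []. Qed.

Let aE (f g : grid R N) i j k : (f + g) i j k = f i j k + g i j k.
Proof. by []. Qed.

Let lapZ a f : lap L (a *: f : grid R N) = a *: lap L f.
Proof.
apply/funext => i; apply/funext => j; apply/funext => k.
by rewrite sE /lap !sE; ring.
Qed.

Let LopZ kappa l (v : grid R N) : lap L v = l *: v ->
  Lop L kappa v = (- (l * ((1 + l) ^+ 2 + kappa))) *: v.
Proof.
move=> E; rewrite /Lop /I_plus_lap.
have E1 : v + lap L v = (1 + l) *: v by rewrite E scalerDl scale1r.
rewrite E1 lapZ E !scalerA -!scalerDl lapZ E scalerA -scaleNr.
congr (_ *: _); ring.
Qed.

(* Eigenvalue of tau *: Lop kappa on the modes of wave vector p. *)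
Let eig tau kappa (p : Q) : R :=
  tau * - (lam p * ((1 + lam p) ^+ 2 + kappa)).

Let Lop_mode tau kappa p y :
  tau *: Lop L kappa (mode p y) = eig tau kappa p *: mode p y.
Proof. by rewrite (LopZ _ (lap_mode p y)) scalerA. Qed.

Let ext (f g : grid R N) : (forall q, at_ f q = at_ g q) -> f = g.
Proof.
move=> H; apply/funext => i; apply/funext => j; apply/funext => k.
exact: (H (i, j, k)).
Qed.

Let sum_mode y x : \sum_p at_ (mode p y) x = N%:R ^+ 3 * (x == y)%:R.
Proof.
case: x y => [[i j] k] [[i' j'] k'].
rewrite !xpair_eqE -!mulnb !natrM.
transitivity ((\sum_(a < N) cos (ang a i i')) * (\sum_(a < N) cos (ang a j j'))
   * (\sum_(a < N) cos (ang a k k'))); last by rewrite !sum_cos; ring.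
rewrite -(pair_bigA _ (fun p1 p2 => at_ (mode (p1, p2) (i', j', k')) (i, j, k))) /=.
rewrite -(pair_bigA _ (fun p1 p2 => \sum_p3 at_ (mode (p1, p2, p3) (i', j', k')) (i, j, k))) /=.
rewrite /at_ /mode /=.
under eq_bigr => a _ do under eq_bigr => b _ do
  (under eq_bigr => c _ do rewrite cosD;
   rewrite big_split/= sumrN -!mulr_sumr sum_sin mulr0 subr0 cosD mulrBl).
under eq_bigr => a _ do
  rewrite big_split/= sumrN -!mulr_suml -!mulr_sumr sum_sin mulr0 mul0r subr0.
by rewrite -!mulr_suml.
Qed.

(* N ^ 3 times the component of f on the modes of wave vector p. *)
Let comp p (f : grid R N) : grid R N := \sum_y at_ f y *: mode p y.

Let compE p f x : at_ (comp p f) x = \sum_y at_ f y * at_ (mode p y) x.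
Proof. by rewrite /comp /at_ !fct_sumE. Qed.

Let atZ a f x : at_ (a *: f) x = a * at_ f x.
Proof. by []. Qed.

Let atS (F : Q -> grid R N) x : at_ (\sum_q F q) x = \sum_q at_ (F q) x.
Proof. by rewrite /at_ !fct_sumE. Qed.

Let expand f : f = (N%:R ^- 3) *: \sum_p comp p f.
Proof.
apply: ext => x; rewrite atZ atS.
under eq_bigr => p _ do rewrite compE.
rewrite exchange_big/=; under eq_bigr => y _ do rewrite -mulr_sumr sum_mode.
rewrite (bigD1 x)//= eqxx big1 => [|y yx].
  by rewrite addr0 mulr1 mulrCA mulVf ?mulr1// expf_neq0.
by rewrite eq_sym (negbTE yx) !mulr0.
Qed.

Let lap_sym f g : \sum_q at_ (lap L f) q * at_ g q =
                  \sum_q at_ f q * at_ (lap L g) q.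
Proof.
have rx (s t : Q -> Q) : cancel s t -> cancel t s -> forall a b : Q -> R,
    \sum_q a (s q) * b q = \sum_q a q * b (t q).
  move=> st ts a b; rewrite (reindex_inj (can_inj ts)).
  by apply: eq_bigr => q _; rewrite ts.
pose s1 q : Q := (ordS q.1.1, q.1.2, q.2).
pose t1 q : Q := (ord_pred q.1.1, q.1.2, q.2).
pose s2 q : Q := (q.1.1, ordS q.1.2, q.2).
pose t2 q : Q := (q.1.1, ord_pred q.1.2, q.2).
pose s3 q : Q := (q.1.1, q.1.2, ordS q.2).
pose t3 q : Q := (q.1.1, q.1.2, ord_pred q.2).
have st1 : cancel s1 t1 by case=> [[a b] c]; rewrite /s1 /t1 /= ordSK.
have ts1 : cancel t1 s1 by case=> [[a b] c]; rewrite /s1 /t1 /= ord_predK.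
have st2 : cancel s2 t2 by case=> [[a b] c]; rewrite /s2 /t2 /= ordSK.
have ts2 : cancel t2 s2 by case=> [[a b] c]; rewrite /s2 /t2 /= ord_predK.
have st3 : cancel s3 t3 by case=> [[a b] c]; rewrite /s3 /t3 /= ordSK.
have ts3 : cancel t3 s3 by case=> [[a b] c]; rewrite /s3 /t3 /= ord_predK.
have D (a b : grid R N) q : at_ (lap L a) q * at_ b q = (mesh L N) ^- 2 *
   (at_ a (s1 q) * at_ b q + at_ a (t1 q) * at_ b q + at_ a (s2 q) * at_ b q
   + at_ a (t2 q) * at_ b q + at_ a (s3 q) * at_ b q + at_ a (t3 q) * at_ b q
   - 6 * (at_ a q * at_ b q)) by rewrite /at_ /lap /=; ring.
rewrite (eq_bigr _ (fun q _ => D f g q)).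
under [RHS]eq_bigr => q _ do rewrite mulrC D.
rewrite -!mulr_sumr; congr (_ * _).
rewrite !big_split/= !sumrN -!mulr_sumr.
rewrite (rx _ _ st1 ts1) (rx _ _ ts1 st1) (rx _ _ st2 ts2) (rx _ _ ts2 st2).
rewrite (rx _ _ st3 ts3) (rx _ _ ts3 st3).
have C (a b : Q -> R) : \sum_q a q * b q = \sum_q b q * a q.
  by apply: eq_bigr => q _; rewrite mulrC.
by rewrite !(C (at_ f)); ring.
Qed.

Let comp_lap p f : comp p (lap L f) = lam p *: comp p f.
Proof.
apply: ext => x; rewrite compE.
under eq_bigr => y _ do rewrite modeC.
rewrite lap_sym lap_mode.
rewrite atZ compE mulr_sumr; apply: eq_bigr => y _.
by rewrite -modeC atZ mulrCA.
Qed.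

Let comp_lin p : linear (comp p).
Proof.
move=> a f g; apply: ext => x; rewrite compE.
transitivity (a * at_ (comp p f) x + at_ (comp p g) x) => //; rewrite !compE mulr_sumr -big_split.
apply: eq_bigr => y _ /=.
have -> : at_ (a *: f + g) y = a * at_ f y + at_ g y by [].
by ring.
Qed.

Let linD (T : grid R N -> grid R N) : linear T -> forall f g, T (f + g) = T f + T g.
Proof. by move=> H f g; have := H 1 f g; rewrite !scale1r. Qed.

Let lin0 (T : grid R N -> grid R N) : linear T -> T 0 = 0.
Proof. by move=> H; apply: (addIr (T 0)); rewrite -linD// !addr0 add0r. Qed.

Let linZ (T : grid R N -> grid R N) : linear T -> forall a f, T (a *: f) = a *: T f.
Proof. by move=> H a f; rewrite -[a *: f]addr0 H lin0// addr0. Qed.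

Let linS (T : grid R N -> grid R N) : linear T ->
  forall (F : Q -> grid R N), T (\sum_q F q) = \sum_q T (F q).
Proof. by move=> H F; apply: (big_morph T (linD H) (lin0 H)). Qed.

Let comp_Lop tau kappa p f : comp p (tau *: Lop L kappa f) = eig tau kappa p *: comp p f.
Proof.
have cD := linD (comp_lin p); have cZ := linZ (comp_lin p).
have cI (g : grid R N) : comp p (I_plus_lap L g) = (1 + lam p) *: comp p g.
  by rewrite /I_plus_lap cD comp_lap scalerDl scale1r.
rewrite cZ /Lop -scaleN1r cZ comp_lap cD cZ !cI !scalerA -!scalerDl !scalerA.
by congr (_ *: _); rewrite /eig; ring.
Qed.

Let sC a b (f : grid R N) : a *: (b *: f) = b *: (a *: f).
Proof. by rewrite !scalerA mulrC. Qed.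

Lemma is_calculus_LopP (phi : R -> R) (tau kappa : R) :
  exists! T, is_calculus phi (fun f : grid R N => tau *: Lop L kappa f) T.
Proof.
pose T f : grid R N :=
  N%:R ^- 3 *: \sum_p phi (eig tau kappa p) *: comp p f.
exists T; split=> [|T' [linT' eigT']]; first split.
- move=> a f g; rewrite /T sC -scalerDr; congr (_ *: _).
  rewrite scaler_sumr -big_split; apply: eq_bigr => p _ /=.
  by rewrite comp_lin scalerDr sC.
- move=> l v Av; rewrite [in RHS](expand v) /T sC.
  congr (_ *: _); rewrite scaler_sumr; apply: eq_bigr => p _.
  have := comp_Lop tau kappa p v; rewrite Av (linZ (comp_lin p)).
  have [-> //|ne /eqP] := eqVneq l (eig tau kappa p).
  by rewrite -subr_eq0 -scalerBl scaler_eq0 subr_eq0 (negbTE ne)/= => /eqP->; rewrite !scaler0.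
- apply/funext => f; rewrite [in RHS](expand f) (linZ linT') linS//; congr (_ *: _).
  apply: eq_bigr => p _; rewrite /comp (linS linT') scaler_sumr.
  apply: eq_bigr => y _; rewrite (linZ linT') (eigT' _ _ (Lop_mode _ _ _ _)).
  by rewrite sC.
Qed.

Lemma phiLP (phi : R -> R) (tau kappa : R) :
  is_calculus phi (fun f : grid R N => tau *: Lop L kappa f)
    (phiL L phi tau kappa).
Proof. by apply: xgetPex; have [T []] := is_calculus_LopP phi tau kappa; exists T. Qed.

End CalculusWellDefined.

(* Main.v *)
Require Import Defs.
From HB Require Import structures.
From mathcomp Require Import all_boot all_order all_algebra.
From mathcomp Require Import all_classical all_reals all_analysis.
From mathcomp Require Import ring lra.

Set Implicit Arguments.
Unset Strict Implicit.
Unset Printing Implicit Defensive.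

Import Order.TTheory GRing.Theory Num.Theory.
Import numFieldNormedType.Exports.

Local Open Scope ring_scope.

(** Write A for minus the discrete Laplacian, G = (I - A)^2, M = G + kappa, and
    n(u) = u^3 - (eps + kappa) u, so that L_kappa = A M and the scheme only sees
    the eigenvalues l >= 0 of A, each with m = (1 - l)^2 + kappa and
    a = tau l m.  Let w be the predictor and v the corrector started from u.

    _Dissipation._  If the sup norms of u, w, v are at most B and
    3 B^2 - eps <= 2 kappa, then kappa dominates half of the second derivative
    of the double well, and [energy_diff_le] gives
      E(w) - E(u) <= < n(u) + M w, w - u >,
      E(v) - E(w) <= < n(w) + M v, v - w >.
    On one mode put s = n(u) + m u and d = n(w) - n(u).  The recurrences
    phi0 = 1 - a phi1 and phi1 = 1 - a phi2 turn all four factors into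
      w - u = - tau l phi1 s,        n(u) + m w = phi0 s,
      v - w = - tau l phi2 d,        n(w) + m v = phi1 d + phi0 s,
    so the two right-hand sides add up to - tau l times the quadratic form
    phi0 phi1 s^2 + phi0 phi2 s d + phi1 phi2 d^2, which is nonnegative since
    phi0 <= phi1 and phi2 <= phi1 ([dissipation_form_ge0],
    [mode_dissipation]).

    _Sup bounds._  By the Sobolev inequality and conservation of the mean they
    follow from bounds on the Laplacians.  For u the energy itself controls
    the Laplacian ([norm2_lap_energy]).  For w and v, on one mode the part of
    the scheme that is linear in u multiplies by
      phi0 + tau (eps + kappa) l phi1 = 1 + tau l (eps - (1 - l)^2) phi1,
    which exceeds 1 only for l < 2, and then by at most 1/8 because the
    inequality between the gradient and the Laplacian forces
    1 / C3^2 <= l for every nonzero l, hence tau <= l / 32.  The cubic part is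
    tau l^2 phi1 u^3, and a phi1^2 <= 1 together with l^2 <= 2 m gives
    (tau l^2 phi1)^2 <= 2 tau l: it is bounded by sqrt(2 tau) times the
    gradient of u^3, which the remaining bounds on tau make small
    ([lap_predictor_le], [lap_step_le]).

    The mode-by-mode reading needs an explicit orthogonal eigenbasis; it is
    given by the products of Hartley functions cas = cos + sin
    ([mode_expansion], [coef_diag], [parseval]). *)

(** * The phi-functions *)

Section PhiFunctions.
Context {R : realType}.
Implicit Types a : R.

Lemma phi0E a : phi0 a = 1 - a * phi1 a.
Proof.
rewrite /phi0 /phi1; have [->|a0] := eqVneq a 0.
  by rewrite oppr0 expR0 mul0r subr0.
by field.
Qed.

Lemma phi1E a : phi1 a = 1 - a * phi2 a.
Proof.
rewrite /phi1 /phi2; have [->|a0] := eqVneq a 0; first by rewrite mul0r subr0.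
by field.
Qed.

Lemma phi0_ge0 a : 0 <= phi0 a. Proof. exact: expR_ge0. Qed.

(** After multiplication by a exp(a) this is 1 + a <= exp(a). *)
Lemma phi0_le_phi1 a : 0 <= a -> phi0 a <= phi1 a.
Proof.
rewrite /phi0 /phi1; have [->|a0 age0] := eqVneq a 0.
  by rewrite oppr0 expR0.
have a1 : 0 < a by rewrite lt_neqAle eq_sym a0.
have E : expR a * expR (- a) = 1 by rewrite expRN divff ?expR_eq0.
rewrite ler_pdivlMr// lerBrDr -[leRHS]E.
have -> : expR (- a) * a + expR (- a) = (1 + a) * expR (- a) by ring.
by rewrite ler_pM2r ?expR_gt0// expR_ge1Dx.
Qed.

Lemma phi2_ge0 a : 0 <= a -> 0 <= phi2 a.
Proof.
rewrite /phi2; have [_|a0 age0] := eqVneq a 0; first by rewrite invr_ge0.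
rewrite divr_ge0 ?sqr_ge0//; have := expR_ge1Dx (- a); lra.
Qed.

(** Both sides times a, this is [phi0_le_phi1] read through the recurrences:
    a phi2 = 1 - phi1 and phi0 = 1 - a phi1. *)
Lemma phi2_le_phi1 a : 0 <= a -> phi2 a <= phi1 a.
Proof.
move=> a0; have [->|an0] := eqVneq a 0.
  by rewrite /phi1 /phi2 eqxx invf_le1 ?ler1n ?ltr0n.
have := phi0_le_phi1 a0; rewrite phi0E => le01.
have a1 : 0 < a by rewrite lt_neqAle eq_sym an0.
rewrite -(ler_pM2l a1); have := phi1E a; lra.
Qed.

Lemma phi1_le1 a : 0 <= a -> phi1 a <= 1.
Proof. by move=> a0; rewrite phi1E gerBl mulr_ge0// phi2_ge0. Qed.

Lemma phi1_ge0 a : 0 <= a -> 0 <= phi1 a.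
Proof. by move=> a0; apply: le_trans (phi0_ge0 a) (phi0_le_phi1 a0). Qed.

(** The parabolic smoothing used below, phi1(a) <= a^(-1/2): it interpolates
    between phi1 <= 1 and a phi1 <= 1. *)
Lemma phi1_sqr_le a : 0 <= a -> a * phi1 a ^+ 2 <= 1.
Proof.
move=> a0; have := phi0_ge0 a; rewrite phi0E subr_ge0 => h.
have := phi1_le1 a0; have := phi1_ge0 a0; nra.
Qed.

(** The cross term is at most phi0 phi2 (s^2 + d^2) / 2, and the diagonal
    coefficients both dominate phi0 phi2. *)
Lemma dissipation_form_ge0 a (s d : R) : 0 <= a ->
  0 <= phi0 a * phi1 a * s ^+ 2 + phi0 a * phi2 a * (s * d)
       + phi1 a * phi2 a * d ^+ 2.
Proof.
move=> a0; have := phi0_le_phi1 a0; have := phi2_le_phi1 a0.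
have := phi0_ge0 a; have := phi2_ge0 a0.
set x := phi0 a; set y := phi1 a; set z := phi2 a => z0 x0 zy xy.
have A := mulr_ge0 (mulr_ge0 x0 z0) (sqr_ge0 (s + d)).
have y0 := le_trans x0 xy.
have B : 0 <= x * (y - z) by rewrite mulr_ge0 ?subr_ge0.
have C : 0 <= z * (y - x) by rewrite mulr_ge0 ?subr_ge0.
have {}B := mulr_ge0 B (sqr_ge0 s); have {}C := mulr_ge0 C (sqr_ge0 d).
have D := mulr_ge0 (mulr_ge0 x0 y0) (sqr_ge0 s).
have E := mulr_ge0 (mulr_ge0 z0 y0) (sqr_ge0 d).
lra.
Qed.

End PhiFunctions.

(** * One Fourier mode of the scheme *)

(** Here l is an eigenvalue of minus the Laplacian; x, y, z are the coefficients
    of the current iterate, of the predictor and of the corrector. *)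
Section OneMode.
Context {R : realType} (l eps kappa tau : R).
Hypotheses (l0 : 0 <= l) (kappa1 : 1 <= kappa) (tau0 : 0 <= tau).
Hypotheses (eps0 : 0 <= eps) (eps1 : eps <= 1).
Let m := (1 - l) ^+ 2 + kappa.
Let a := tau * (l * m).

Let m0 : 0 <= m.
Proof. by rewrite addr_ge0 ?sqr_ge0// (le_trans ler01 kappa1). Qed.

Let a0 : 0 <= a. Proof. by rewrite !mulr_ge0. Qed.

(** One mode of the upper bound for the total change of energy.  Here n and n'
    are arbitrary: the nonlinearity does not act mode by mode, and the estimate
    treats its coefficients as data. *)
Lemma mode_dissipation (x y z n n' : R) :
  y = phi0 a * x - tau * (phi1 a * (l * n)) ->
  z = phi0 a * x - tau * ((phi1 a - phi2 a) * (l * n) + phi2 a * (l * n')) ->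
  (n + m * y) * (y - x) + (n' + m * z) * (z - y) <= 0.
Proof.
move=> yE zE; set s := n + m * x; set d := n' - n.
have yx : y - x = - (tau * l) * (phi1 a * s).
  by rewrite yE phi0E /s /a; ring.
have zy : z - y = - (tau * l) * (phi2 a * d) by rewrite zE yE /d; ring.
have ny : n + m * y = phi0 a * s.
  by rewrite -[y](subrK x) yx /s phi0E /a; ring.
have nz : n' + m * z = phi1 a * d + phi0 a * s.
  have -> : n' + m * z = d + (n + m * y) + m * (z - y) by rewrite /d; ring.
  by rewrite ny zy [in RHS]phi1E /a; ring.
rewrite ny nz yx zy.
have := mulr_ge0 (mulr_ge0 tau0 l0) (dissipation_form_ge0 s d a0); lra.
Qed.

(** A step size small against the nonzero spectrum: the growth factor below
    exceeds 1 only on the low modes, where this makes the excess small. *)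
Hypothesis gap : l = 0 \/ 32 * tau <= l.

(** The factor by which the linear part of a predictor step multiplies a
    mode. *)
Let growth := phi0 a + tau * (eps + kappa) * l * phi1 a.

Let growth_ge0 : 0 <= growth.
Proof.
rewrite addr_ge0 ?phi0_ge0// !mulr_ge0 ?phi1_ge0//.
by rewrite addr_ge0// (le_trans ler01 kappa1).
Qed.

Let growth_le : growth <= 9 / 8.
Proof.
have E : growth = 1 + tau * l * (eps - (1 - l) ^+ 2) * phi1 a.
  by rewrite /growth phi0E /a /m; ring.
rewrite E; have p0 := phi1_ge0 a0; have p1 := phi1_le1 a0.
case: gap => [->|taul]; first by rewrite mulr0 !mul0r; lra.
(* The excess over 1 is positive only if (1 - l)^2 < eps <= 1, so l <= 2 and
   tau l <= l^2 / 32 <= 1 / 8. *)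
have [neg|pos] := leP (eps - (1 - l) ^+ 2) 0.
  have : 0 <= tau * l * - (eps - (1 - l) ^+ 2) * phi1 a.
    by rewrite !mulr_ge0 ?oppr_ge0.
  lra.
have l2 : l <= 2.
  have [//|l2] := leP l 2; suff : 1 < eps by rewrite ltNge eps1.
  have : 0 <= l * (l - 2) by rewrite mulr_ge0// subr_ge0 ltW.
  lra.
have A : tau * l <= 1 / 8.
  have : 0 <= (2 - l) * l + 2 * (2 - l) by rewrite addr_ge0 ?mulr_ge0 ?subr_ge0.
  have : 0 <= (l - 32 * tau) * l by rewrite mulr_ge0 ?subr_ge0.
  lra.
have B : tau * l * (eps - (1 - l) ^+ 2) <= tau * l.
  apply: ler_piMr; first exact: mulr_ge0.
  have := eps1; have := sqr_ge0 (1 - l); lra.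
have C : tau * l * (eps - (1 - l) ^+ 2) * phi1 a <= tau * l * (eps - (1 - l) ^+ 2).
  by rewrite ler_piMr// mulr_ge0 ?mulr_ge0// ltW.
lra.
Qed.

(** The factor in front of the cubic term of l times a predictor step. *)
Let smoothing := tau * l ^+ 2 * phi1 a.

(** Only one factor l is left on the right, so that summing against squared
    coefficients produces a gradient norm, not a Laplacian norm. *)
Let smoothing_sqr_le : smoothing ^+ 2 <= 2 * tau * l.
Proof.
have lm : l ^+ 2 <= 2 * m by rewrite /m; have := kappa1; have := sqr_ge0 (l - 2); lra.
have ap := phi1_sqr_le a0.
have -> : smoothing ^+ 2 = tau * l * (tau * l * phi1 a ^+ 2 * l ^+ 2).
  by rewrite /smoothing; ring.
have tl := mulr_ge0 tau0 l0.
rewrite -[2 * tau * l]mulrA [2 * _]mulrC ler_wpM2l//.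
apply: (@le_trans _ _ (2 * (a * phi1 a ^+ 2))); last by lra.
have -> : 2 * (a * phi1 a ^+ 2) = tau * l * phi1 a ^+ 2 * (2 * m).
  by rewrite /a; ring.
by rewrite ler_wpM2l// mulr_ge0 ?sqr_ge0.
Qed.

(** Young weights chosen so that 3/2 (9/8)^2 <= 2. *)
Let sub_sqr_le (x y : R) : (x - y) ^+ 2 <= 3 / 2 * x ^+ 2 + 3 * y ^+ 2.
Proof. have := sqr_ge0 (x + 2 * y); lra. Qed.

Let comb_sqr_le (p q x y : R) : 0 <= p -> 0 <= q ->
  (p * x + q * y) ^+ 2 <= (p + q) ^+ 2 * (x ^+ 2 + y ^+ 2).
Proof.
move=> p0 q0; have := sqr_ge0 (p * y - q * x).
have := mulr_ge0 (mulr_ge0 p0 q0) (addr_ge0 (sqr_ge0 x) (sqr_ge0 y)); lra.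
Qed.

Let growth_sqr : 3 / 2 * growth ^+ 2 <= 2.
Proof.
have := growth_ge0; have := growth_le; nra.
Qed.

Lemma mode_predictor_le (x c y : R) :
  y = phi0 a * x - tau * (phi1 a * (l * (c - (eps + kappa) * x))) ->
  (l * y) ^+ 2 <= 2 * (l * x) ^+ 2 + 6 * tau * (l * c ^+ 2).
Proof.
move=> ->.
have -> : l * (phi0 a * x - tau * (phi1 a * (l * (c - (eps + kappa) * x))))
  = growth * (l * x) - smoothing * c by rewrite /growth /smoothing; ring.
apply: le_trans (sub_sqr_le _ _) _.
have := ler_wpM2r (sqr_ge0 (l * x)) growth_sqr.
have := ler_wpM2r (sqr_ge0 c) smoothing_sqr_le.
lra.
Qed.

(** The corrector averages the data of u and of the predictor with nonnegative
    weights, since phi2 <= phi1; those weights add up to the two factors of the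
    predictor step, so the same bounds serve again. *)
Lemma mode_step_le (x c y d z : R) :
  z = phi0 a * x
    - tau * ((phi1 a - phi2 a) * (l * (c - (eps + kappa) * x))
             + phi2 a * (l * (d - (eps + kappa) * y))) ->
  (l * z) ^+ 2 <= 2 * ((l * x) ^+ 2 + (l * y) ^+ 2)
    + 6 * tau * (l * c ^+ 2 + l * d ^+ 2).
Proof.
have e0 : 0 <= eps + kappa by rewrite addr_ge0// (le_trans ler01 kappa1).
have p2 := phi2_ge0 a0; have p12 := phi2_le_phi1 a0.
move=> ->; pose p := phi0 a + tau * (eps + kappa) * l * (phi1 a - phi2 a).
pose q := tau * (eps + kappa) * l * phi2 a.
pose r := tau * l ^+ 2 * (phi1 a - phi2 a); pose s := tau * l ^+ 2 * phi2 a.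
have -> : l * (phi0 a * x
    - tau * ((phi1 a - phi2 a) * (l * (c - (eps + kappa) * x))
             + phi2 a * (l * (d - (eps + kappa) * y))))
  = (p * (l * x) + q * (l * y)) - (r * c + s * d).
  by rewrite /p /q /r /s; ring.
apply: le_trans (sub_sqr_le _ _) _.
have A : (p * (l * x) + q * (l * y)) ^+ 2
      <= growth ^+ 2 * ((l * x) ^+ 2 + (l * y) ^+ 2).
  have -> : growth = p + q by rewrite /growth /p /q; ring.
  apply: comb_sqr_le; last by rewrite !mulr_ge0.
  by rewrite addr_ge0 ?phi0_ge0// !mulr_ge0 ?subr_ge0.
have B : (r * c + s * d) ^+ 2 <= smoothing ^+ 2 * (c ^+ 2 + d ^+ 2).
  have -> : smoothing = r + s by rewrite /smoothing /r /s; ring.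
  by apply: comb_sqr_le; rewrite mulr_ge0 ?subr_ge0// mulr_ge0 ?sqr_ge0.
have := ler_wpM2r (addr_ge0 (sqr_ge0 (l * x)) (sqr_ge0 (l * y))) growth_sqr.
have := ler_wpM2r (addr_ge0 (sqr_ge0 c) (sqr_ge0 d)) smoothing_sqr_le.
move: A B; lra.
Qed.

End OneMode.

(** * Hartley functions on one period *)

Section GridFunctions.
Context {R : realType} {N : nat} (hN : (0 < N)%N).

(** The Hartley kernel: unlike cos and sin alone, its samples form one real
    orthogonal basis indexed by the wave numbers 0, ..., N - 1. *)
Definition cas (x : R) : R := cos x + sin x.

Definition freq : R := pi *+ 2 / N%:R.

Let N0 : N%:R != 0 :> R. Proof. by rewrite pnatr_eq0 -lt0n. Qed.

Lemma freqN : freq * N%:R = pi *+ 2. Proof. by rewrite mulfVK. Qed.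

Lemma sin_wrap x (m : nat) : sin (x + freq * (m * N)%:R) = sin x.
Proof.
rewrite natrM mulrCA freqN mulrC mulr_natr.
exact: (periodicn (@sinD2pi R)).
Qed.

Lemma cos_wrap x (m : nat) : cos (x + freq * (m * N)%:R) = cos x.
Proof.
rewrite natrM mulrCA freqN mulrC mulr_natr.
exact: (periodicn (@cosD2pi R)).
Qed.

Lemma cas_wrap x (m : nat) : cas (x + freq * (m * N)%:R) = cas x.
Proof. by rewrite /cas sin_wrap cos_wrap. Qed.

(** The reflection a -> N - a changes the sign of each term. *)
Lemma sum_sin_freq (m : nat) : \sum_(a < N) sin (freq * (a * m)%:R) = 0.
Proof.
have E : \sum_(0 <= a < N.+1) sin (freq * (a * m)%:R)
         = \sum_(a < N) sin (freq * (a * m)%:R).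
  rewrite big_nat_recr//= big_mkord -[X in sin X]add0r mulnC sin_wrap.
  by rewrite sin0 addr0.
suff: \sum_(0 <= a < N.+1) sin (freq * (a * m)%:R)
      = - \sum_(0 <= a < N.+1) sin (freq * (a * m)%:R).
  by move/eqP; rewrite E -addr_eq0 -mulr2n mulrn_eq0 => /eqP.
rewrite [LHS]big_nat_rev/= -sumrN; apply: eq_big_nat => a /andP[_ aN].
rewrite add0n subSS -sinN -(sin_wrap (- _) m); congr sin.
rewrite mulnBl natrB ?leq_mul2r ?(ltnSE aN) ?orbT// mulnC; ring.
Qed.

(** Multiplied by 2 sin(t / 2), with t the common difference of the angles, the
    sum telescopes. *)
Lemma sum_cos_freq (m : nat) : (0 < m < N)%N ->
  \sum_(a < N) cos (freq * (a * m)%:R) = 0.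
Proof.
move=> /andP[m0 mN]; set t := freq * m%:R.
have s0 : 2 * sin (t / 2) != 0.
  rewrite mulf_neq0 ?pnatr_eq0// gt_eqF// sin_gt0_pi//.
  have -> : t / 2 = pi * (m%:R / N%:R) by rewrite /t /freq; field.
  rewrite mulr_gt0 ?pi_gt0 ?divr_gt0 ?ltr0n//=.
  by rewrite gtr_pMr ?pi_gt0// ltr_pdivrMr ?ltr0n// mul1r ltr_nat.
apply: (mulfI s0); rewrite mulr0 mulr_sumr.
rewrite -(big_mkord xpredT (fun a => 2 * sin (t / 2) * cos (freq * (a * m)%:R))).
rewrite (@telescope_sumr_eq _ _ _ (fun a => sin (a%:R * t - t / 2)))//.
  have -> : N%:R * t - t / 2 = - (t / 2) + freq * (m * N)%:R.
    by rewrite /t natrM; ring.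
  by rewrite sin_wrap mul0r sub0r subrr.
move=> k _; rewrite -[k.+1%:R]natr1.
have -> : freq * (k * m)%:R = k%:R * t by rewrite /t natrM; ring.
have -> : (k%:R + 1) * t - t / 2 = k%:R * t + t / 2 by field.
rewrite sinD sinB; ring.
Qed.

(** The wave number a and the node i play symmetric roles, which makes the
    orthogonality of the modes and their completeness the same fact. *)
Definition mode1 (a i : nat) : R := cas (freq * (a * i)%:R).

Lemma mode1C a i : mode1 a i = mode1 i a. Proof. by rewrite /mode1 mulnC. Qed.

Lemma mode1_mod a i : mode1 a (i %% N) = mode1 a i.
Proof.
rewrite /mode1 [in RHS](divn_eq i N) mulnDr mulnA natrD mulrDr addrC.
by rewrite cas_wrap.
Qed.

(** From cas x cas y = cos (x - y) + sin (x + y). *)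
Lemma mode1_orth (i j : 'I_N) :
  \sum_(a < N) mode1 a i * mode1 a j = N%:R * (i == j)%:R.
Proof.
wlog ji : i j / (j <= i)%N => [H|].
  case/orP: (leq_total j i) => [|ij]; first exact: H.
  by rewrite eq_sym -H//; apply: eq_bigr => a _; rewrite mulrC.
have E (a : 'I_N) : mode1 a i * mode1 a j
    = cos (freq * (a * (i - j))%:R) + sin (freq * (a * (i + j))%:R).
  rewrite /mode1 /cas mulnBr mulnDr natrB ?leq_mul2l ?ji ?orbT// natrD.
  rewrite [freq * (_ - _)]mulrBr [freq * (_ + _)]mulrDr cosB sinD; ring.
under eq_bigr do rewrite E; rewrite big_split/= sum_sin_freq addr0.
have [->|ij] := eqVneq i j.
  under eq_bigr do rewrite subnn muln0 mulr0 cos0.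
  by rewrite sumr_const card_ord mulr1.
rewrite sum_cos_freq ?mulr0// subn_gt0 (leq_ltn_trans (leq_subr _ _) (ltn_ord i)).
by rewrite andbT ltn_neqAle ji andbT eq_sym.
Qed.

Lemma mode1_shift (a : nat) (i : 'I_N) :
  mode1 a (ordS i) + mode1 a (ord_pred i) = 2 * cos (freq * a%:R) * mode1 a i.
Proof.
rewrite /= !mode1_mod /mode1.
have -> : freq * (a * i.+1)%:R = freq * (a * i)%:R + freq * a%:R.
  by rewrite mulnS natrD; ring.
have -> : freq * (a * (i + N).-1)%:R
          = freq * (a * i)%:R - freq * a%:R + freq * (a * N)%:R.
  rewrite -subn1 mulnBr muln1 natrB ?leq_pmulr ?addn_gt0 ?hN ?orbT//.
  by rewrite mulnDr natrD; ring.
rewrite cas_wrap /cas cosD sinD cosB sinB; ring.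
Qed.


(** * The Hartley basis of grid functions *)

Variable L : R.
Hypothesis hL : 0 < L.
Local Notation h := (mesh L N).
Local Notation wave := ('I_N * 'I_N * 'I_N)%type.
Implicit Types (p q x y : wave) (f g u v : grid R N).

Lemma mesh_gt0 : 0 < h. Proof. by rewrite divr_gt0 ?ltr0n. Qed.

Definition at_ f x : R := f x.1.1 x.1.2 x.2.

Definition mode p : grid R N :=
  fun i j k => mode1 p.1.1 i * mode1 p.1.2 j * mode1 p.2 k.

Lemma modeC p x : at_ (mode p) x = at_ (mode x) p.
Proof.
by rewrite /at_ /mode (mode1C p.1.1) (mode1C p.1.2) (mode1C p.2).
Qed.

Lemma gridP f g : (forall x, at_ f x = at_ g x) -> f = g.
Proof.
move=> H; apply/funext => i; apply/funext => j; apply/funext => k.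
exact: (H (i, j, k)).
Qed.

Lemma at_D f g x : at_ (f + g) x = at_ f x + at_ g x.
Proof. by []. Qed.

Lemma at_Z a f x : at_ (a *: f : grid R N) x = a * at_ f x.
Proof. by []. Qed.

Lemma at_sum (F : wave -> grid R N) x : at_ (\sum_p F p) x = \sum_p at_ (F p) x.
Proof. by rewrite /at_ !fct_sumE. Qed.

Lemma mode_orth x y :
  \sum_p at_ (mode p) x * at_ (mode p) y = N%:R ^+ 3 * (x == y)%:R.
Proof.
case: x y => [[i j] k] [[i' j'] k']; rewrite !xpair_eqE -!mulnb !natrM.
transitivity ((\sum_(a < N) mode1 a i * mode1 a i')
  * (\sum_(a < N) mode1 a j * mode1 a j')
  * (\sum_(a < N) mode1 a k * mode1 a k')); last by rewrite !mode1_orth; ring.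
rewrite big_distrlr/= pair_bigA big_distrlr/= pair_bigA/=.
by apply: eq_bigr => -[[a b] c] _; rewrite /at_ /mode /=; ring.
Qed.

Definition dot f g : R := \sum_x at_ f x * at_ g x.

Lemma dot_mode p q : dot (mode p) (mode q) = N%:R ^+ 3 * (p == q)%:R.
Proof.
rewrite -mode_orth; apply: eq_bigr => x _.
by rewrite (modeC p) (modeC q).
Qed.

Lemma sum_grid (F : 'I_N -> 'I_N -> 'I_N -> R) :
  \sum_(i < N) \sum_(j < N) \sum_(k < N) F i j k
  = \sum_x F x.1.1 x.1.2 x.2.
Proof. by rewrite pair_bigA pair_bigA. Qed.

Lemma innerE f g : inner L f g = h ^+ 3 * dot f g.
Proof. by rewrite /inner sum_grid. Qed.

Lemma mode_expansion f :
  f = N%:R ^- 3 *: \sum_p dot f (mode p) *: mode p.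
Proof.
apply: gridP => x.
rewrite at_Z at_sum; under eq_bigr do rewrite at_Z.
under eq_bigr do rewrite mulr_suml.
rewrite exchange_big/= (bigD1 x)//= [X in _ + X]big1 => [|y yx].
  under eq_bigr do rewrite -mulrA.
  rewrite -mulr_sumr mode_orth eqxx mulr1 addr0 mulrCA mulVf ?mulr1//.
  by rewrite expf_neq0.
under eq_bigr do rewrite -mulrA.
by rewrite -mulr_sumr mode_orth (negbTE yx) !mulr0.
Qed.

(** The weight makes [parseval] hold with constant 1. *)
Definition coef p f : R := Num.sqrt (h ^+ 3 / N%:R ^+ 3) * dot f (mode p).

Lemma coefD p f g : coef p (f + g) = coef p f + coef p g.
Proof.
rewrite /coef -mulrDr; congr (_ * _); rewrite /dot -big_split.
by apply: eq_bigr => x _; rewrite at_D mulrDl.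
Qed.

Lemma coefZ p a f : coef p (a *: f : grid R N) = a * coef p f.
Proof.
rewrite /coef [RHS]mulrCA; congr (_ * _); rewrite /dot mulr_sumr.
by apply: eq_bigr => x _; rewrite at_Z -mulrA.
Qed.

Lemma coefB p f g : coef p (f - g) = coef p f - coef p g.
Proof. by rewrite -scaleN1r coefD coefZ mulN1r. Qed.

Let K0 : 0 < h ^+ 3 / N%:R ^+ 3.
Proof. by rewrite divr_gt0// exprn_gt0 ?mesh_gt0 ?ltr0n. Qed.

Lemma parseval f g : inner L f g = \sum_p coef p f * coef p g.
Proof.
under eq_bigr do
  rewrite /coef mulrACA -expr2 sqr_sqrtr ?(ltW K0)//.
transitivity (h ^+ 3 * (N%:R ^- 3 * \sum_p dot f (mode p) * dot g (mode p))).
  rewrite innerE; congr (_ * _); rewrite {1}(mode_expansion f).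
  rewrite [LHS]/dot; under eq_bigr do rewrite at_Z at_sum -mulrA mulr_suml.
  rewrite -mulr_sumr exchange_big/=; congr (_ * _); apply: eq_bigr => p _.
  rewrite [X in _ = _ * X]/dot mulr_sumr.
  by apply: eq_bigr => x _; rewrite at_Z -mulrA [at_ _ _ * at_ g x]mulrC.
by rewrite mulrA mulr_sumr.
Qed.

(** This covers the Laplacian and all functions of L_kappa at once, without any
    appeal to their symmetry. *)
Lemma coef_diag (T : grid R N -> grid R N) (mu : wave -> R) : linear T ->
  (forall p, T (mode p) = mu p *: mode p) ->
  forall p f, coef p (T f) = mu p * coef p f.
Proof.
move=> linT Tmode p f.
have TD g k : T (g + k) = T g + T k by have := linT 1 g k; rewrite !scale1r.
have T0 : T 0 = 0 by apply: (addIr (T 0)); rewrite -TD !addr0 add0r.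
have TZ a g : T (a *: g) = a *: T g.
  by have := linT a g 0; rewrite T0 !addr0.
have Tf : T f = N%:R ^- 3 *: \sum_q (dot f (mode q) * mu q) *: mode q.
  rewrite {1}(mode_expansion f) TZ (big_morph T TD T0); congr (_ *: _).
  by apply: eq_bigr => q _; rewrite TZ Tmode scalerA.
rewrite /coef [RHS]mulrCA; congr (_ * _); rewrite Tf.
transitivity (N%:R ^- 3 * \sum_q dot f (mode q) * mu q * dot (mode q) (mode p)).
  rewrite [LHS]/dot; under eq_bigr do rewrite at_Z at_sum -mulrA mulr_suml.
  rewrite -mulr_sumr exchange_big/=; congr (_ * _).
  apply: eq_bigr => q _; rewrite [X in _ = _ * X]/dot mulr_sumr.
  by apply: eq_bigr => x _; rewrite at_Z -!mulrA.
rewrite (bigD1 p)//= [X in _ + X]big1 => [|q qp].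
  by rewrite dot_mode eqxx mulr1 addr0; field.
by rewrite dot_mode (negbTE qp) !mulr0.
Qed.


(** * Spectra and discrete norms *)

(** The eigenvalues of minus the Laplacian. *)
Definition lam p : R := h ^- 2 * (6 - 2 * cos (freq * p.1.1%:R)
  - 2 * cos (freq * p.1.2%:R) - 2 * cos (freq * p.2%:R)).

Lemma lam_ge0 p : 0 <= lam p.
Proof.
apply: mulr_ge0; first by rewrite invr_ge0 exprn_ge0 ?(ltW mesh_gt0).
have := cos_le1 (freq * p.1.1%:R); have := cos_le1 (freq * p.1.2%:R).
have := cos_le1 (freq * p.2%:R); lra.
Qed.

Lemma lap_mode p : lap L (mode p) = (- lam p) *: mode p.
Proof.
apply: gridP => -[[i j] k]; rewrite [RHS]at_Z /at_ /lap /mode /lam /=.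
have E0 := mode1_shift p.1.1 i; have E1 := mode1_shift p.1.2 j.
have E2 := mode1_shift p.2 k; rewrite /= in E0 E1 E2.
have := mesh_gt0; set H := mesh L N => H0.
move: E0 E1 E2.
set a := mode1 _ (i.+1 %% N); set a' := mode1 _ ((i + N).-1 %% N).
set b := mode1 _ (j.+1 %% N); set b' := mode1 _ ((j + N).-1 %% N).
set c := mode1 _ (k.+1 %% N); set c' := mode1 _ ((k + N).-1 %% N).
set x := mode1 _ i; set y := mode1 _ j; set z := mode1 _ k.
move=> E0 E1 E2.
transitivity (H ^- 2 * ((a + a') * y * z + x * (b + b') * z
  + x * y * (c + c') - 6 * (x * y * z))); first by congr (_ * _); ring.
rewrite E0 E1 E2; ring.
Qed.

Lemma lap_linear : linear (lap L : grid R N -> grid R N).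
Proof.
move=> a f g; apply: gridP => x; rewrite [RHS]at_D [X in _ = X + _]at_Z /at_ /lap.
have E i j k : (a *: f + g : grid R N) i j k = a * f i j k + g i j k by [].
rewrite !E; ring.
Qed.

Lemma coef_lap p f : coef p (lap L f) = - lam p * coef p f.
Proof. exact: (coef_diag lap_linear lap_mode). Qed.

Definition Lop_eig (kappa : R) p : R := lam p * ((1 - lam p) ^+ 2 + kappa).

Lemma Lop_mode kappa p : Lop L kappa (mode p) = Lop_eig kappa p *: mode p.
Proof.
have lapZ a f : lap L (a *: f) = a *: lap L f.
  have lap0 : lap L 0 = 0 :> grid R N.
    by apply: gridP => x; rewrite /at_ /lap /= !addr0 mulr0 subr0 mulr0.
  by have := lap_linear a f 0; rewrite lap0 !addr0.
rewrite /Lop /I_plus_lap lap_mode.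
rewrite -{1 3}[mode p]scale1r -!scalerDl lapZ lap_mode.
rewrite !scalerA -!scalerDl lapZ lap_mode scalerA -scaleNr.
by congr (_ *: _); rewrite /Lop_eig; ring.
Qed.

Lemma coef_phiL phi tau kappa p f :
  coef p (phiL L phi tau kappa f) = phi (tau * Lop_eig kappa p) * coef p f.
Proof.
have [lin eig] := phiLP L hN phi tau kappa.
apply: (coef_diag (mu := fun q => phi (tau * Lop_eig kappa q)) lin) => q.
apply: eig.
by rewrite Lop_mode scalerA.
Qed.

(** Summation by parts on a cycle. *)
Lemma sum_sq_diff (F : 'I_N -> R) (c : R) :
  \sum_i ((F (ordS i) - F i) / c) ^+ 2
  = - (\sum_i c ^- 2 * (F (ordS i) + F (ord_pred i) - 2 * F i) * F i).
Proof.
have S1 : \sum_i F (ordS i) ^+ 2 = \sum_i F i ^+ 2.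
  by rewrite [RHS](reindex_inj (can_inj (@ordSK N))).
have S2 : \sum_i F (ord_pred i) * F i = \sum_i F i * F (ordS i).
  rewrite (reindex_inj (can_inj (@ordSK N))).
  by apply: eq_bigr => i _; rewrite ordSK.
transitivity (c ^- 2 * \sum_i (F (ordS i) ^+ 2 - 2 * (F i * F (ordS i)) + F i ^+ 2)).
  by rewrite mulr_sumr; apply: eq_bigr => i _; rewrite -exprVn; ring.
under [in RHS]eq_bigr do rewrite -mulrA; rewrite -mulr_sumr -mulrN.
congr (_ * _).
rewrite !big_split/= S1 sumrN -mulr_sumr.
transitivity (- (\sum_i (F (ord_pred i) * F i + F i * F (ordS i)  - 2 * F i ^+ 2))).
  rewrite !big_split/= S2 !sumrN -!mulr_sumr; ring.
by congr (- _); apply: eq_bigr => i _; ring.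
Qed.

Lemma norm2_sq f : norm2 L f ^+ 2 = inner L f f.
Proof.
rewrite sqr_sqrtr// innerE mulr_ge0 ?exprn_ge0 ?(ltW mesh_gt0)//.
by apply: sumr_ge0 => x _; rewrite -expr2 sqr_ge0.
Qed.

Lemma norm2_grad_sq_sum f : norm2_grad L f ^+ 2 = h ^+ 3 *
  \sum_(i < N) \sum_(j < N) \sum_(k < N)
    (Dx L f i j k ^+ 2 + Dy L f i j k ^+ 2 + Dz L f i j k ^+ 2).
Proof.
rewrite sqr_sqrtr.
  congr (_ * _); apply: eq_bigr => i _; apply: eq_bigr => j _.
  by apply: eq_bigr => k _; rewrite !real_normK ?num_real.
rewrite mulr_ge0 ?exprn_ge0 ?(ltW mesh_gt0)//.
apply: sumr_ge0 => i _; apply: sumr_ge0 => j _; apply: sumr_ge0 => k _.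
by rewrite !addr_ge0 ?exprn_ge0.
Qed.

Lemma norm2_grad_sq f : norm2_grad L f ^+ 2 = - inner L (lap L f) f.
Proof.
rewrite norm2_grad_sq_sum /inner -mulrN; congr (_ * _).
have E i j k : lap L f i j k * f i j k =
    h ^- 2 * (f (ordS i) j k + f (ord_pred i) j k - 2 * f i j k) * f i j k
  + h ^- 2 * (f i (ordS j) k + f i (ord_pred j) k - 2 * f i j k) * f i j k
  + h ^- 2 * (f i j (ordS k) + f i j (ord_pred k) - 2 * f i j k) * f i j k.
  by rewrite /lap; ring.
under [in RHS]eq_bigr do under eq_bigr do under eq_bigr do rewrite E.
have D (F G K : 'I_N -> 'I_N -> 'I_N -> R) :
    \sum_i \sum_j \sum_k (F i j k + G i j k + K i j k)
  = \sum_j \sum_k \sum_i F i j k + \sum_i \sum_k \sum_j G i j k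
    + \sum_i \sum_j \sum_k K i j k.
  under eq_bigr do (under eq_bigr do rewrite !big_split/=; rewrite !big_split/=).
  rewrite !big_split/=; congr (_ + _ + _).
    by rewrite exchange_big; apply: eq_bigr => j _; rewrite exchange_big.
  by apply: eq_bigr => i _; rewrite exchange_big.
rewrite !D !opprD -!sumrN; congr (_ + _ + _).
- apply: eq_bigr => j _; rewrite -sumrN; apply: eq_bigr => k _.
  exact: (sum_sq_diff (fun i => f i j k)).
- apply: eq_bigr => i _; rewrite -sumrN; apply: eq_bigr => k _.
  exact: (sum_sq_diff (fun j => f i j k)).
- apply: eq_bigr => i _; rewrite -sumrN; apply: eq_bigr => j _.
  exact: (sum_sq_diff (fun k => f i j k)).
Qed.

Lemma parseval_grad f : norm2_grad L f ^+ 2 = \sum_p lam p * coef p f ^+ 2.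
Proof.
rewrite norm2_grad_sq parseval -sumrN; apply: eq_bigr => p _.
by rewrite coef_lap; ring.
Qed.

Lemma parseval_lap f : norm2 L (lap L f) ^+ 2 = \sum_p (lam p * coef p f) ^+ 2.
Proof.
rewrite norm2_sq parseval; apply: eq_bigr => p _.
by rewrite coef_lap; ring.
Qed.

(** Testing the inequality on a single mode gives sqrt(lam) <= C lam. *)
Lemma lam_gap (C : R) : 0 < C ->
  (forall f, norm2_grad L f <= C * norm2 L (lap L f)) ->
  forall p, lam p = 0 \/ 1 <= C ^+ 2 * lam p.
Proof.
move=> C0 HC p; have l0 := lam_ge0 p.
have [->|l1] := eqVneq (lam p) 0; [by left|right].
have lgt : 0 < lam p by rewrite lt_neqAle eq_sym l1.
have c0 : 0 < coef p (mode p).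
  by rewrite /coef dot_mode eqxx mulr1 mulr_gt0 ?sqrtr_gt0 ?exprn_gt0 ?ltr0n.
have cq q : q != p -> coef q (mode p) = 0.
  by move=> qp; rewrite /coef dot_mode eq_sym (negbTE qp) !mulr0.
have : norm2_grad L (mode p) ^+ 2 <= (C * norm2 L (lap L (mode p))) ^+ 2.
  by rewrite ler_sqr ?HC// nnegrE ?mulr_ge0 ?sqrtr_ge0 ?(ltW C0).
have S (F : wave -> R) : (forall q, q != p -> F q = 0) -> \sum_q F q = F p.
  by move=> F0; rewrite (bigD1 p)//= big1 ?addr0.
rewrite exprMn parseval_grad parseval_lap !S; last 2 first.
- by move=> q /cq ->; rewrite mulr0 expr0n.
- by move=> q /cq ->; rewrite expr0n mulr0.
have -> : C ^+ 2 * (lam p * coef p (mode p)) ^+ 2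
        = C ^+ 2 * lam p * (lam p * coef p (mode p) ^+ 2) by ring.
by rewrite ler_pMl// mulr_gt0 ?exprn_gt0.
Qed.

(** * The scheme and the energy in the basis *)

Definition cube u : grid R N := fun i j k => u i j k ^+ 3.

Lemma coef_fop eps kappa p u : coef p (fop L eps kappa u)
  = - (lam p * (coef p (cube u) - (eps + kappa) * coef p u)).
Proof. by rewrite /fop coefB (coefZ _ (eps + kappa)) !coef_lap /cube; ring. Qed.

Lemma coef_predictor eps kappa tau p u (a := tau * Lop_eig kappa p) :
  coef p (etdrk2_predictor L eps kappa tau u) = phi0 a * coef p u
  - tau * (phi1 a * (lam p * (coef p (cube u) - (eps + kappa) * coef p u))).
Proof.
rewrite /etdrk2_predictor coefD (coefZ _ tau) !coef_phiL coef_fop -/a; ring.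
Qed.

Lemma coef_step eps kappa tau p u (a := tau * Lop_eig kappa p)
    (w := etdrk2_predictor L eps kappa tau u) :
  coef p (etdrk2_step L eps kappa tau u) = phi0 a * coef p u
  - tau * ((phi1 a - phi2 a)
             * (lam p * (coef p (cube u) - (eps + kappa) * coef p u))
    + phi2 a * (lam p * (coef p (cube w) - (eps + kappa) * coef p w))).
Proof.
rewrite /etdrk2_step coefD (coefZ _ tau) coefD coefB !coef_phiL !coef_fop -/a -/w; ring.
Qed.

Lemma dot_quartic u :
  dot (fun i j k => u i j k ^+ 4) (fun _ _ _ => 1) = \sum_x at_ u x ^+ 4.
Proof. by apply: eq_bigr => x _; rewrite mulr1. Qed.

(** The double well is kept in physical space, where it is pointwise; the
    quadratic part is completed to half of |(I + Delta_h) u|^2, which is diagonal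
    in the basis. *)
Lemma energyE eps u : energy L eps u =
  h ^+ 3 * \sum_x (at_ u x ^+ 4 / 4 - eps / 2 * at_ u x ^+ 2)
  + \sum_p (1 - lam p) ^+ 2 / 2 * coef p u ^+ 2.
Proof.
rewrite /energy parseval_grad parseval_lap norm2_sq.
have -> : (1 - eps) / 2 * inner L u u
        = 2^-1 * (\sum_p coef p u * coef p u) - eps / 2 * inner L u u.
  by rewrite -parseval; ring.
rewrite !innerE dot_quartic big_split/= sumrN -mulr_suml -mulr_sumr.
have -> : dot u u = \sum_x at_ u x ^+ 2 by apply: eq_bigr => x _; rewrite expr2.
have -> : \sum_p (1 - lam p) ^+ 2 / 2 * coef p u ^+ 2
  = 2^-1 * (\sum_p coef p u * coef p u) - (\sum_p lam p * coef p u ^+ 2)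
    + 2^-1 * (\sum_p (lam p * coef p u) ^+ 2).
  by rewrite !mulr_sumr -sumrN -!big_split; apply: eq_bigr => p _ /=; field.
ring.
Qed.

Lemma inner_one : inner L (fun _ _ _ : 'I_N => 1) (fun _ _ _ => 1) = vol L.
Proof.
rewrite innerE /dot /vol /mesh; under eq_bigr do rewrite mulr1.
by rewrite sumr_const !card_prod !card_ord -mulr_natr !natrM; field.
Qed.

(** The gradient is absorbed mode by mode through l <= l^2 / 4 + 1, and the
    resulting multiple of u^2 by the quartic term, t^4 / 4 + 1 >= t^2. *)
Lemma norm2_lap_energy eps u : 0 <= eps <= 1 ->
  norm2 L (lap L u) ^+ 2 <= 4 * (energy L eps u + vol L).
Proof.
move=> /andP[e0 e1]; rewrite energyE -inner_one innerE.
have P : h ^+ 3 * \sum_x at_ u x ^+ 2 = \sum_p coef p u ^+ 2.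
  under [RHS]eq_bigr do rewrite expr2.
  by rewrite -parseval innerE.
have A : h ^+ 3 * \sum_x (at_ u x ^+ 4 / 4 - eps / 2 * at_ u x ^+ 2)
    + h ^+ 3 * dot (fun _ _ _ : 'I_N => 1 : R) (fun _ _ _ => 1)
    >= 2^-1 * (h ^+ 3 * \sum_x at_ u x ^+ 2).
  rewrite mulrCA -mulrDr ler_pM2l ?exprn_gt0 ?mesh_gt0//.
  rewrite /dot mulr_sumr -big_split; apply: ler_sum => x _ /=.
  rewrite mulr1 -[at_ (fun _ _ _ => 1) x]/(1 : R); set t := at_ u x.
  have : eps * t ^+ 2 <= t ^+ 2 by rewrite ler_piMl ?sqr_ge0.
  have := sqr_ge0 (t ^+ 2 / 2 - 1); nra.
rewrite P in A.
have B : 4^-1 * norm2 L (lap L u) ^+ 2 <=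
    \sum_p (1 - lam p) ^+ 2 / 2 * coef p u ^+ 2
    + (2^-1) * \sum_p coef p u ^+ 2.
  rewrite parseval_lap !mulr_sumr -big_split; apply: ler_sum => p _ /=.
  set c := coef p u; set l := lam p.
  have := sqr_ge0 ((l - 2) * c); nra.
lra.
Qed.

Lemma le_norm_sup f x : `|at_ f x| <= norm_sup f.
Proof.
rewrite /norm_sup /at_.
apply: le_trans (le_bigmax _ _ x.1.1).
apply: le_trans (le_bigmax _ _ x.1.2).
exact: (le_bigmax _ (fun k => `|f x.1.1 x.1.2 k|) x.2).
Qed.

(** Taylor expansion of the double well: its second derivative is at most
    3 B^2 - eps on [-B, B]. *)
Lemma quartic_diff_le (eps kappa B s t : R) : 3 * B ^+ 2 - eps <= 2 * kappa ->
  `|s| <= B -> `|t| <= B ->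
  (t ^+ 4 / 4 - eps / 2 * t ^+ 2) - (s ^+ 4 / 4 - eps / 2 * s ^+ 2)
  <= (s ^+ 3 - eps * s) * (t - s) + kappa * (t - s) ^+ 2.
Proof.
move=> hk; rewrite !ler_norml => /andP[s1 s2] /andP[t1 t2].
have Q : t ^+ 2 + 2 * s * t + 3 * s ^+ 2 <= 6 * B ^+ 2 by nra.
have := sqr_ge0 (t - s); set D := (t - s) ^+ 2 => D0.
have -> : (t ^+ 4 / 4 - eps / 2 * t ^+ 2) - (s ^+ 4 / 4 - eps / 2 * s ^+ 2)
  = (s ^+ 3 - eps * s) * (t - s)
    + D * ((t ^+ 2 + 2 * s * t + 3 * s ^+ 2) / 4 - eps / 2).
  by rewrite /D; field.
rewrite lerD2l mulrC; apply: ler_wpM2r => //; lra.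
Qed.

(** The quadratic remainder kappa |v - u|^2 moves the factor kappa from u to v,
    and convexity of the quadratic energy moves G from the midpoint to v: both
    linear terms become implicit, as in the splitting of the scheme. *)
Lemma energy_diff_le eps kappa (B : R) u v : 3 * B ^+ 2 - eps <= 2 * kappa ->
  (forall x, `|at_ u x| <= B) -> (forall x, `|at_ v x| <= B) ->
  energy L eps v - energy L eps u <=
  \sum_p (coef p (cube u) - (eps + kappa) * coef p u
          + ((1 - lam p) ^+ 2 + kappa) * coef p v) * (coef p v - coef p u).
Proof.
move=> hk uB vB.
have A : h ^+ 3 * (\sum_x (at_ v x ^+ 4 / 4 - eps / 2 * at_ v x ^+ 2))
       - h ^+ 3 * (\sum_x (at_ u x ^+ 4 / 4 - eps / 2 * at_ u x ^+ 2))
    <= inner L (cube u - eps *: u) (v - u) + kappa * inner L (v - u) (v - u).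
  rewrite !innerE mulrCA -mulrDr -mulrBr ler_pM2l ?exprn_gt0 ?mesh_gt0//.
  rewrite /dot mulr_sumr -sumrN -!big_split; apply: ler_sum => x _ /=.
  rewrite -expr2; exact: (quartic_diff_le hk (uB x) (vB x)).
rewrite !energyE opprD addrACA.
apply: le_trans (lerD A (lexx _)) _.
rewrite !parseval mulr_sumr -sumrN -!big_split; apply: ler_sum => p _ /=.
rewrite !coefB (coefZ _ eps).
set c := coef p (cube u); set s := coef p u; set t := coef p v.
set l := lam p.
have := mulr_ge0 (sqr_ge0 (1 - l)) (sqr_ge0 (t - s)); lra.
Qed.

(** A discrete chain rule: t^3 - s^3 = (t^2 + t s + s^2) (t - s). *)
Lemma norm2_grad_cube (B : R) u : (forall x, `|at_ u x| <= B) ->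
  norm2_grad L (cube u) <= 3 * B ^+ 2 * norm2_grad L u.
Proof.
move=> uB; have h0 := mesh_gt0.
have B0 : 0 <= 3 * B ^+ 2 by rewrite mulr_ge0// sqr_ge0.
have P (s t : R) : `|s| <= B -> `|t| <= B ->
    ((t ^+ 3 - s ^+ 3) / h) ^+ 2 <= (3 * B ^+ 2) ^+ 2 * ((t - s) / h) ^+ 2.
  rewrite !ler_norml => /andP[s1 s2] /andP[t1 t2].
  have Q : 0 <= t ^+ 2 + t * s + s ^+ 2 <= 3 * B ^+ 2.
    have := sqr_ge0 (t + s); have := sqr_ge0 t; have := sqr_ge0 s.
    by move=> *; apply/andP; split; nra.
  have -> : (t ^+ 3 - s ^+ 3) / h = (t ^+ 2 + t * s + s ^+ 2) * ((t - s) / h).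
    by ring.
  rewrite exprMn ler_wpM2r ?sqr_ge0//.
  by case/andP: Q => Q0 Q1; rewrite ler_sqr ?nnegrE.
rewrite -ler_sqr ?nnegrE; last 2 first.
- exact: sqrtr_ge0.
- exact: mulr_ge0 B0 (sqrtr_ge0 _).
rewrite [leRHS]exprMn !norm2_grad_sq_sum mulrCA ler_pM2l ?exprn_gt0//.
rewrite mulr_sumr; apply: ler_sum => i _; rewrite mulr_sumr.
apply: ler_sum => j _; rewrite mulr_sumr; apply: ler_sum => k _.
rewrite !mulrDr; apply: lerD; first apply: lerD.
- exact: P (uB (i, j, k)) (uB (ordS i, j, k)).
- exact: P (uB (i, j, k)) (uB (i, ordS j, k)).
- exact: P (uB (i, j, k)) (uB (i, j, ordS k)).
Qed.

(** The mean depends only on the coefficients with eigenvalue 0, on which a step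
    is the identity. *)
Lemma mean_etdrk2 eps kappa tau u :
  mean L (etdrk2_predictor L eps kappa tau u) = mean L u
  /\ mean L (etdrk2_step L eps kappa tau u) = mean L u.
Proof.
(* The constant 1 is orthogonal to every mode with nonzero eigenvalue, because
   its Laplacian vanishes. *)
have one p : lam p * coef p (fun _ _ _ => 1) = 0.
  have : lap L (fun _ _ _ : 'I_N => 1 : R) = 0 :> grid R N.
    by apply: gridP => x; transitivity (0 : R) => //; rewrite /at_ /lap; ring.
  move/(congr1 (coef p)); rewrite coef_lap => E.
  by apply/eqP; rewrite -oppr_eq0 -mulNr E -(scale0r (mode p)) (coefZ _ 0) mul0r.
have M f : (forall p, lam p = 0 -> coef p f = coef p u) -> mean L f = mean L u.
  move=> H; rewrite /mean !parseval; congr (_ * _); apply: eq_bigr => p _.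
  have /eqP := one p; rewrite mulf_eq0 => /orP[/eqP/H->//|/eqP->].
  by rewrite !mulr0.
have p0 : phi0 (0 : R) = 1 by rewrite /phi0 oppr0 expR0.
split; apply: M => p lp.
  by rewrite coef_predictor /Lop_eig lp !mul0r !mulr0 p0; ring.
by rewrite coef_step /Lop_eig lp !mul0r !mulr0 p0; ring.
Qed.

Lemma energy_step_le eps kappa tau (B : R) u
    (w := etdrk2_predictor L eps kappa tau u)
    (v := etdrk2_step L eps kappa tau u) :
  1 <= kappa -> 0 <= tau -> 3 * B ^+ 2 - eps <= 2 * kappa ->
  norm_sup u <= B -> norm_sup w <= B -> norm_sup v <= B ->
  energy L eps v <= energy L eps u.
Proof.
move=> k1 t0 hk uB wB vB.
have S f : norm_sup f <= B -> forall x, `|at_ f x| <= B.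
  by move=> fB x; apply: le_trans (le_norm_sup f x) fB.
rewrite -subr_le0 -(subrKA (energy L eps w)) addrC.
apply: le_trans (lerD (energy_diff_le hk (S _ uB) (S _ wB))
  (energy_diff_le hk (S _ wB) (S _ vB))) _.
rewrite -big_split; apply: sumr_le0 => p _ /=.
apply: (mode_dissipation (lam_ge0 p) k1 t0 (coef_predictor eps kappa tau p u)).
exact: coef_step.
Qed.

(** * Bounds on the Laplacian after one step *)

Section LaplacianBounds.
Context (C3 eps kappa tau : R) (u : grid R N).
Hypotheses (C30 : 0 < C3) (kappa1 : 1 <= kappa) (tau0 : 0 <= tau).
Hypotheses (eps0 : 0 <= eps) (eps1 : eps <= 1).
Hypothesis grad_le : forall f, norm2_grad L f <= C3 * norm2 L (lap L f).
Hypothesis tauC3 : tau * C3 ^+ 2 <= 32^-1.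
Let w := etdrk2_predictor L eps kappa tau u.
Let v := etdrk2_step L eps kappa tau u.

Let gap p : lam p = 0 \/ 32 * tau <= lam p.
Proof.
have [->|] := lam_gap C30 grad_le p; [by left|right].
have C0 : 0 < C3 ^+ 2 by rewrite exprn_gt0.
rewrite -(ler_pM2r C0); have := tauC3; lra.
Qed.

Lemma lap_predictor_le : norm2 L (lap L w) ^+ 2
  <= 2 * norm2 L (lap L u) ^+ 2 + 6 * tau * norm2_grad L (cube u) ^+ 2.
Proof.
rewrite !parseval_lap parseval_grad !mulr_sumr -big_split.
apply: ler_sum => p _ /=.
exact: (mode_predictor_le (lam_ge0 p) kappa1 tau0 eps0 eps1 (gap p)
  (coef_predictor eps kappa tau p u)).
Qed.

Lemma lap_step_le : norm2 L (lap L v) ^+ 2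
  <= 2 * (norm2 L (lap L u) ^+ 2 + norm2 L (lap L w) ^+ 2)
     + 6 * tau * (norm2_grad L (cube u) ^+ 2 + norm2_grad L (cube w) ^+ 2).
Proof.
rewrite !parseval_lap !parseval_grad -!big_split !mulr_sumr -big_split.
apply: ler_sum => p _ /=.
exact: (mode_step_le (lam_ge0 p) kappa1 tau0 eps0 eps1 (gap p)
  (coef_step eps kappa tau p u)).
Qed.

End LaplacianBounds.

End GridFunctions.

(** * Energy decay *)

(** At C = 0 the convention 0^-1 = 0 leaves tau <= 0 as the hypothesis. *)
Lemma mul_sqr_le (R : realType) (tau k C : R) : 0 < tau -> 0 <= k ->
  tau <= k * C ^- 2 -> tau * C ^+ 2 <= k.
Proof.
move=> t0 k0; have [->|C0] := eqVneq C 0; first by rewrite expr0n/= mulr0.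
by rewrite ler_pdivlMr// exprn_even_gt0.
Qed.

Theorem theorem3p1 (R : realType) (L : R) (hL : 0 < L) (C2 C3 : R)
  (hC2 : 0 < C2) (hC3 : 0 < C3)
  (sobolev_sup : forall (M : nat) (f : grid R M), (0 < M)%N ->
     norm_sup f <= C2 * (`|mean L f| + norm2 L (lap L f)))
  (sobolev_grad : forall (M : nat) (f : grid R M), (0 < M)%N ->
     norm2_grad L f <= C3 * norm2 L (lap L f))
  (eps : R) (heps0 : 0 < eps) (heps1 : eps < 1)
  (N : nat) (hN : (0 < N)%N) (u0 : grid R N) :
  let beta0 := mean L u0 in
  let Ct0 := energy L eps u0 in
  let Ct1 := 2 * Num.sqrt (Ct0 + vol L) in
  let Ct2 := C2 * (`|beta0| + Ct1) in
  let Ct3 := 3 * Ct2 ^+ 2 * C3 * Ct1 in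
  let Ct4 := Num.sqrt (2 * Ct1 ^+ 2 + 1) in
  let Ct5 := C2 * (`|beta0| + Ct4) in
  let Ct6 := 3 * Ct5 ^+ 2 * C3 * Ct4 in
  let Ct9 := Num.sqrt (7 * Ct1 ^+ 2 + 4 + 3 / 8 * (Ct2 + Ct4) ^+ 2) in
  let Ct10 := C2 * (`|beta0| + Ct9) in
  let kappa := Num.max ((3 * Ct10 ^+ 2 - eps) / 2) 1 in
  forall (tau : R), 0 < tau ->
  tau <= Num.min (kappa `^ (- (3 / 2)))
           (Num.min (32^-1 * C3 ^- 2)
             (Num.min (36^-1 * Ct3 ^- 2) (12^-1 * Ct6 ^- 2))) ->
  forall (NT : nat) (u : nat -> grid R N),
  u 0%N = u0 ->
  (forall n : nat, (n < NT)%N ->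
     u n.+1 = etdrk2_step L eps kappa tau (u n)) ->
  forall n : nat, (n < NT)%N -> energy L eps (u n.+1) <= energy L eps (u n).
Proof.
move=> beta0 Ct0 Ct1 Ct2 Ct3 Ct4 Ct5 Ct6 Ct9 Ct10 kappa.
move=> tau tau0; rewrite !le_min => /and4P[_ tau3 tau4 tau6] NT u uz us.
have {}tau3 : tau * C3 ^+ 2 <= 32^-1.
  by apply: mul_sqr_le tau0 _ tau3; rewrite invr_ge0.
have {}tau4 : tau * Ct3 ^+ 2 <= 36^-1.
  by apply: mul_sqr_le tau0 _ tau4; rewrite invr_ge0.
have {}tau6 : tau * Ct6 ^+ 2 <= 12^-1.
  by apply: mul_sqr_le tau0 _ tau6; rewrite invr_ge0.
have e01 : 0 <= eps <= 1 by rewrite !ltW.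
have k1 : 1 <= kappa by rewrite le_max lexx orbT.
have kB : 3 * Ct10 ^+ 2 - eps <= 2 * kappa.
  by rewrite [leRHS]mulrC -ler_pdivrMr// le_max lexx.
have n2 (f : grid R N) : 0 <= norm2 L (lap L f) by exact: sqrtr_ge0.
have E0 : 0 <= Ct0 + vol L.
  have := le_trans (sqr_ge0 _) (norm2_lap_energy hN hL u0 e01).
  by rewrite pmulr_rge0.
have C1sq : Ct1 ^+ 2 = 4 * (Ct0 + vol L).
  by rewrite exprMn sqr_sqrtr//; congr (_ * _); rewrite expr2 -natrM.
have C4sq : Ct4 ^+ 2 = 2 * Ct1 ^+ 2 + 1.
  by rewrite sqr_sqrtr// addr_ge0// mulr_ge0// sqr_ge0.
have C9sq : Ct9 ^+ 2 = 7 * Ct1 ^+ 2 + 4 + 3 / 8 * (Ct2 + Ct4) ^+ 2.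
  by rewrite sqr_sqrtr// !addr_ge0// mulr_ge0// sqr_ge0.
have C10 : 0 <= Ct1 by rewrite mulr_ge0// sqrtr_ge0.
have C40 : 0 <= Ct4 by exact: sqrtr_ge0.
have C90 : 0 <= Ct9 by exact: sqrtr_ge0.
have s24 := sqr_ge0 (Ct2 + Ct4).
have s1 := sqr_ge0 Ct1.
have C49 : Ct4 <= Ct9 by rewrite -ler_sqr ?nnegrE// C4sq C9sq; lra.
have C14 : Ct1 <= Ct4 by rewrite -ler_sqr ?nnegrE// C4sq; lra.
have sup (f : grid R N) (S : R) : mean L f = beta0 -> 0 <= S ->
    norm2 L (lap L f) ^+ 2 <= S ^+ 2 -> norm_sup f <= C2 * (`|beta0| + S).
  move=> mf S0; rewrite ler_sqr ?nnegrE// => fS.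
  apply: le_trans (sobolev_sup N f hN) _.
  by rewrite mf ler_pM2l// lerD2l.
have grad (f : grid R N) (S : R) : mean L f = beta0 -> 0 <= S ->
    norm2 L (lap L f) ^+ 2 <= S ^+ 2 ->
    norm2_grad L (cube f) ^+ 2 <= (3 * (C2 * (`|beta0| + S)) ^+ 2 * C3 * S) ^+ 2.
  move=> mf S0 fS; have fB := sup f S mf S0 fS.
  have B0 := mulr_ge0 (ler0n R 3) (sqr_ge0 (C2 * (`|beta0| + S))).
  rewrite ler_sqr ?nnegrE; last 2 first.
  - exact: sqrtr_ge0.
  - exact: mulr_ge0 (mulr_ge0 B0 (ltW hC3)) S0.
  apply: le_trans (norm2_grad_cube hN hL (fun x => le_trans (le_norm_sup f x) fB)) _.
  rewrite -[leRHS]mulrA.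
  apply: ler_wpM2l => //.
  apply: le_trans (sobolev_grad N f hN) _.
  by rewrite ler_pM2l// -ler_sqr ?nnegrE.
have step (f : grid R N) : mean L f = beta0 -> energy L eps f <= Ct0 ->
    energy L eps (etdrk2_step L eps kappa tau f) <= energy L eps f.
  move=> mf Ef; have [mw mv] := mean_etdrk2 hN hL eps kappa tau f.
  have fS : norm2 L (lap L f) ^+ 2 <= Ct1 ^+ 2.
    by apply: le_trans (norm2_lap_energy hN hL f e01) _; rewrite C1sq; lra.
  have fG := grad f Ct1 mf C10 fS.
  have t0 := ltW tau0.
  have gN := fun f : grid R N => sobolev_grad N f hN.
  have := lap_predictor_le hN hL f hC3 k1 t0 (ltW heps0) (ltW heps1) gN tau3.
  have := lap_step_le hN hL f hC3 k1 t0 (ltW heps0) (ltW heps1) gN tau3.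
  set w := etdrk2_predictor _ _ _ _ _; set v := etdrk2_step _ _ _ _ _.
  rewrite -/w -/v in mw mv *.
  move=> vle wle.
  have fG' := ler_wpM2l t0 fG.
  have wS : norm2 L (lap L w) ^+ 2 <= 2 * Ct1 ^+ 2 + 1 / 6.
    apply: le_trans wle _; rewrite -/Ct2 -/Ct3 in fG'; lra.
  have wS4 : norm2 L (lap L w) ^+ 2 <= Ct4 ^+ 2 by rewrite C4sq; lra.
  have wG' := ler_wpM2l t0 (grad w Ct4 (etrans mw mf) C40 wS4).
  have vS : norm2 L (lap L v) ^+ 2 <= Ct9 ^+ 2.
    apply: le_trans vle _.
    rewrite -/Ct2 -/Ct3 in fG'; rewrite -/Ct5 -/Ct6 in wG'; rewrite C9sq; lra.
  (* The three radii Ct1 <= Ct4 <= Ct9 share the bound Ct10 that defines kappa. *)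
  have up (S : R) : 0 <= S -> S <= Ct9 -> forall g : grid R N, mean L g = beta0 ->
      norm2 L (lap L g) ^+ 2 <= S ^+ 2 -> norm_sup g <= Ct10.
    move=> S0 S9 g mg gS; apply: le_trans (sup g S mg S0 gS) _.
    by rewrite ler_pM2l// lerD2l.
  apply: (energy_step_le hN hL k1 t0 kB).
  - exact: (up Ct1 C10 (le_trans C14 C49) f mf fS).
  - exact: (up Ct4 C40 C49 w (etrans mw mf) wS4).
  - exact: (up Ct9 C90 (lexx _) v (etrans mv mf) vS).
(* The constants refer to u0 only, so the induction carries its mean and the
   bound by its energy along. *)
have inv n : (n <= NT)%N -> mean L (u n) = beta0 /\ energy L eps (u n) <= Ct0.
  elim: n => [|n IH] nT; first by rewrite uz.
  have [mn En] := IH (ltnW nT); rewrite us//.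
  have [_ ->] := mean_etdrk2 hN hL eps kappa tau (u n).
  by split=> //; apply: le_trans (step _ mn En) En.
by move=> n nT; have [mn En] := inv n (ltnW nT); rewrite us//; apply: step.
Qed.
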